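(* Let $F$ be an algebraically closed field of characteristic zero. The special, orthogonal and symplectic Lie algebras $\mathfrak{sl}_\infty(F)$, $\mathfrak{o}_\infty(F)$ and $\mathfrak{sp}_\infty(F)$ are graded strongly nondegenerate Lie algebras with respect to the 3-gradings described in the context. Moreover, they are strongly nondegenerate Lie algebras.
   Context: $\mathbb{M}_\infty(F)=\bigcup_{n\ge 1}\mathbb{M}_n(F)$ is the algebra of infinite matrices (rows and columns indexed by the positive integers) with finitely many nonzero entries, and $\mathfrak{gl}_\infty(F)=\mathbb{M}_\infty(F)^-$ with bracket $[a,b]=ab-ba$. Let $y$ be the infinite block diagonal matrix all of whose diagonal blocks are $\begin{pmatrix}0&1\\-1&0\end{pmatrix}$. Then $\mathfrak{sl}_\infty(F)=\{x\in\mathfrak{gl}_\infty(F)\mid \mathrm{tr}(x)=0\}$, $\mathfrak{o}_\infty(F)=\{x\in\mathfrak{gl}_\infty(F)\mid x^t+x=0\}$, $\mathfrak{sp}_\infty(F)=\{x\in\mathfrak{gl}_\infty(F)\mid x^ty+yx=0\}$. The 3-gradings $L=L_{-1}\oplus L_0\oplus L_1$: (1) $L=\mathfrak{sl}_\infty(F)$: fix a nonzero natural number $n$ and write matrices in block form $\begin{pmatrix}a&b\\c&d\end{pmatrix}$ with $a\in\mathbb{M}_n(F)$, $b\in\mathbb{M}_{n,\infty}(F)$, $c\in\mathbb{M}_{\infty,n}(F)$, $d\in\mathfrak{gl}_\infty(F)$ (finitely many nonzero entries). $L_{-1}$ consists of the matrices in $L$ with only the block $c$ nonzero, $L_1$ of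 those with only the block $b$ nonzero, and $L_0=\left\{\begin{pmatrix}a&0\\0&d\end{pmatrix}\mid \mathrm{tr}(a)+\mathrm{tr}(d)=0\right\}$. (2) $L=\mathfrak{o}_\infty(F)$: $L$ is identified (through an isomorphism given by a change of basis) with the Lie algebra of block matrices $\begin{pmatrix}a&b\\c&-a^t\end{pmatrix}$ with $a\in\mathfrak{gl}_\infty(F)$ and $b,c\in\{x\in\mathfrak{gl}_\infty(F)\mid x^t=-x\}$; $L_{-1}$, $L_0$, $L_1$ are the sets of matrices $\begin{pmatrix}0&0\\c&0\end{pmatrix}$, $\begin{pmatrix}a&0\\0&-a^t\end{pmatrix}$, $\begin{pmatrix}0&b\\0&0\end{pmatrix}$ respectively. (3) $L=\mathfrak{sp}_\infty(F)$: the same as in (2), with $b,c\in\{x\in\mathfrak{gl}_\infty(F)\mid x^t=x\}$. A Lie algebra $L$ is strongly nondegenerate if $(\mathrm{ad}_x)^2=0$ implies $x=0$ for all $x\in L$ (where $\mathrm{ad}_x(y)=[x,y]$). A graded Lie algebra is graded strongly nondegenerate if $(\mathrm{ad}_x)^2=0$ implies $x=0$ for all homogeneous $x\in L$. *)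

(* Defs.v *)
From HB Require Import structures.
From mathcomp Require Import all_boot all_order all_algebra.
From mathcomp Require Import mathcomp_extra boolp classical_sets functions.
From mathcomp Require Import cardinality fsbigop ring.

Set Implicit Arguments.
Unset Strict Implicit.
Unset Printing Implicit Defensive.

Import GRing.Theory.

Local Open Scope classical_set_scope.
Local Open Scope ring_scope.

HB.mixin Record Lmodule_isLieAlgebra (F : fieldType) L of GRing.Lmodule F L := {
  lie : L -> L -> L;
  lie_linearl : forall (a : F) (x y z : L),
    lie (a *: x + y) z = a *: lie x z + lie y z;
  lie_linearr : forall (a : F) (x y z : L),
    lie z (a *: x + y) = a *: lie z x + lie z y;
  liexx : forall x : L, lie x x = 0;
  lie_jacobi : forall x y z : L,
    lie x (lie y z) + lie y (lie z x) + lie z (lie x y) = 0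
}.

#[short(type="lieAlgType")]
HB.structure Definition LieAlgebra (F : fieldType) :=
  {L of GRing.Lmodule F L & Lmodule_isLieAlgebra F L}.

Definition ad (F : fieldType) (L : lieAlgType F) (x : L) : L -> L :=
  fun y => lie x y.

Definition strongly_nondegenerate (F : fieldType) (L : lieAlgType F) : Prop :=
  forall x : L, (forall y : L, ad x (ad x y) = 0) -> x = 0.

Definition components3 (F : fieldType) (L : lieAlgType F)
    (Lm1 L0 L1 : set L) : int -> set L :=
  fun i => if i == -1 then Lm1 else if i == 0 then L0
           else if i == 1 then L1 else [set 0].

Definition is_subspace (F : fieldType) (L : lieAlgType F) (A : set L) : Prop :=
  A 0 /\ forall (a : F) (x y : L), A x -> A y -> A (a *: x + y).

Definition is_3grading (F : fieldType) (L : lieAlgType F)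
    (G : int -> set L) : Prop :=
  [/\ forall i, is_subspace (G i),
      forall i, i \notin [:: -1; 0; 1] -> G i = [set 0],
      forall x : L, exists! t : L * L * L,
        [/\ G (-1) t.1.1, G 0 t.1.2, G 1 t.2 & x = t.1.1 + t.1.2 + t.2]
    & forall i j x y, G i x -> G j y -> G (i + j) (lie x y)].

Definition graded_strongly_nondegenerate (F : fieldType) (L : lieAlgType F)
    (G : int -> set L) : Prop :=
  is_3grading G /\
  forall x : L, (exists i, G i x) ->
    (forall y : L, ad x (ad x y) = 0) -> x = 0.

Definition lie_isomorphism (F : fieldType) (L M : lieAlgType F)
    (phi : L -> M) : Prop :=
  [/\ forall (a : F) (x y : L), phi (a *: x + y) = a *: phi x + phi y,
      forall x y : L, phi (lie x y) = lie (phi x) (phi y)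
    & bijective phi].

Record lieSubalgebra (F : fieldType) (L : lieAlgType F) := LieSubalgebra {
  lsa_set :> set L;
  lsa_subspace : is_subspace lsa_set;
  lsa_lie : forall x y : L, lsa_set x -> lsa_set y -> lsa_set (lie x y)
}.

Section SubalgebraType.
Context {F : fieldType} {L : lieAlgType F} (S : lieSubalgebra L).

Definition lsa_pred : {pred L} := [pred x | `[< lsa_set S x >]].

Lemma lsa_submod_closed : GRing.submod_closed lsa_pred.
Proof.
have [S0 SD] := lsa_subspace S.
split; first exact/asboolP.
by move=> a x y /asboolP Sx /asboolP Sy; apply/asboolP/SD.
Qed.

HB.instance Definition _ :=
  GRing.isSubmodClosed.Build F L lsa_pred lsa_submod_closed.

Record lsa_type := LsaType { lsa_val : L; lsa_valP : lsa_val \in lsa_pred }.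

HB.instance Definition _ := [isSub for lsa_val].
HB.instance Definition _ := [Choice of lsa_type by <:].
HB.instance Definition _ := [SubChoice_isSubLmodule of lsa_type by <:].

Lemma lsa_lie_pred (x y : lsa_type) : lie (lsa_val x) (lsa_val y) \in lsa_pred.
Proof.
by apply/asboolP/lsa_lie; apply/asboolP; [apply: (valP x)|apply: (valP y)].
Qed.

Definition lsa_lieop (x y : lsa_type) : lsa_type := LsaType (lsa_lie_pred x y).

Lemma lsa_lie_linearl (a : F) (x y z : lsa_type) :
  lsa_lieop (a *: x + y) z = a *: lsa_lieop x z + lsa_lieop y z.
Proof. by apply/val_inj; rewrite /= lie_linearl. Qed.

Lemma lsa_lie_linearr (a : F) (x y z : lsa_type) :
  lsa_lieop z (a *: x + y) = a *: lsa_lieop z x + lsa_lieop z y.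
Proof. by apply/val_inj; rewrite /= lie_linearr. Qed.

Lemma lsa_liexx (x : lsa_type) : lsa_lieop x x = 0.
Proof. by apply/val_inj; rewrite /= liexx. Qed.

Lemma lsa_lie_jacobi (x y z : lsa_type) :
  lsa_lieop x (lsa_lieop y z) + lsa_lieop y (lsa_lieop z x)
    + lsa_lieop z (lsa_lieop x y) = 0.
Proof. by apply/val_inj; rewrite /= lie_jacobi. Qed.

HB.instance Definition _ := Lmodule_isLieAlgebra.Build F lsa_type
  lsa_lie_linearl lsa_lie_linearr lsa_liexx lsa_lie_jacobi.

End SubalgebraType.

Definition imatrix (F : fieldType) (I J : choiceType) : Type := I -> J -> F.

HB.instance Definition _ (F : fieldType) (I J : choiceType) :=
  GRing.Lmodule.copy (imatrix F I J) (I -> J -> F^o).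

(** [\sum_(j \in [set: J])] is the sum of a finitely supported family (and 0 on
    the other families).  Infinite matrices that are not finitary are only ever
    multiplied when all the sums involved have finite support. *)
Definition imulmx (F : fieldType) (I J K : choiceType)
    (x : imatrix F I J) (y : imatrix F J K) : imatrix F I K :=
  fun i k => \sum_(j \in [set: J]) (x i j * y j k).

Definition itrmx (F : fieldType) (I J : choiceType)
    (x : imatrix F I J) : imatrix F J I := fun j i => x i j.

Definition imx1 (F : fieldType) (I : choiceType) : imatrix F I I :=
  fun i j => (i == j)%:R.
Arguments imx1 {F I}.

Definition itrace (F : fieldType) (I : choiceType) (x : imatrix F I I) : F :=
  \sum_(i \in [set: I]) x i i.

Definition row_finite (F : fieldType) (I J : choiceType)
    (x : imatrix F I J) : Prop :=
  forall i, finite_set [set j | x i j != 0].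

Definition col_finite (F : fieldType) (I J : choiceType)
    (x : imatrix F I J) : Prop :=
  forall j, finite_set [set i | x i j != 0].

Definition finitary (F : fieldType) (I J : choiceType)
    (x : imatrix F I J) : Prop :=
  finite_set [set p : I * J | x p.1 p.2 != 0].

Section ImatrixTheory.
Context {F : fieldType}.
Implicit Types I J K L : choiceType.

Lemma imatrixP I J (x y : imatrix F I J) : (forall i j, x i j = y i j) -> x = y.
Proof. by move=> xy; apply/funext => i; apply/funext => j. Qed.

Lemma imxD I J (x y : imatrix F I J) i j : (x + y) i j = x i j + y i j.
Proof. by []. Qed.

Lemma imxZ I J (a : F) (x : imatrix F I J) i j : (a *: x) i j = a * x i j.
Proof. by []. Qed.

Lemma imxN I J (x : imatrix F I J) i j : (- x) i j = - x i j.
Proof. by rewrite -scaleN1r imxZ mulN1r. Qed.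

Lemma imx0 I J i j : (0 : imatrix F I J) i j = 0.
Proof. by []. Qed.

Definition imxE := (imxD, imxZ, imxN, imx0).

Lemma finite_support (T : choiceType) (f : T -> F) :
  finite_set [set i | f i != 0] ->
  exists2 s, uniq s & forall i, i \notin s -> f i = 0.
Proof.
move=> /finite_seqP[s sE]; exists (undup s); first exact: undup_uniq.
move=> i; rewrite mem_undup; apply: contraNeq => fi.
by have : [set` s] i by rewrite -sE.
Qed.

Lemma fsumE (T : choiceType) (s : seq T) (f : T -> F) :
  uniq s -> (forall i, i \notin s -> f i = 0) ->
  \sum_(i \in [set: T]) f i = \sum_(i <- s) f i.
Proof.
move=> us sf; rewrite [RHS]fsbig_seq //; apply/esym/fsbig_widen => // i [_ /negP].
exact: sf.
Qed.

Lemma itrmxK I J (x : imatrix F I J) : itrmx (itrmx x) = x.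
Proof. by []. Qed.

Lemma itrmx_mul I J K (x : imatrix F I J) (y : imatrix F J K) :
  itrmx (imulmx x y) = imulmx (itrmx y) (itrmx x).
Proof.
by apply: imatrixP => i j; apply: eq_fsbigr => k _; rewrite mulrC.
Qed.

Lemma finitary_tr I J (x : imatrix F I J) : finitary x -> finitary (itrmx x).
Proof.
move=> /(finite_image (fun p => (p.2, p.1))); apply: sub_finite_set.
by move=> [j i] /= xij; exists (i, j).
Qed.

Lemma finitary_row I J (x : imatrix F I J) : finitary x -> row_finite x.
Proof.
move=> /(finite_image snd) + i; apply: sub_finite_set => j /= xij.
by exists (i, j).
Qed.

Lemma finitary_col I J (x : imatrix F I J) : finitary x -> col_finite x.
Proof.
move=> /(finite_image fst) + j; apply: sub_finite_set => i /= xij.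
by exists (i, j).
Qed.

Lemma imulmxDl I J K (x y : imatrix F I J) (z : imatrix F J K) :
  col_finite z -> imulmx (x + y) z = imulmx x z + imulmx y z.
Proof.
move=> zf; apply: imatrixP => i k; have [s us sz] := finite_support (zf k).
rewrite /imulmx imxD !(fsumE us) => [|j|j|j]; try by move=> /sz ->; rewrite mulr0.
by rewrite -big_split; apply: eq_bigr => j _; rewrite !imxE mulrDl.
Qed.

Lemma imulmxDr I J K (x y : imatrix F J K) (z : imatrix F I J) :
  row_finite z -> imulmx z (x + y) = imulmx z x + imulmx z y.
Proof.
move=> zf; apply: imatrixP => i k; have [s us sz] := finite_support (zf i).
rewrite /imulmx imxD !(fsumE us) => [|j|j|j]; try by move=> /sz ->; rewrite mul0r.
by rewrite -big_split; apply: eq_bigr => j _; rewrite !imxE mulrDr.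
Qed.

Lemma imulmxZl I J K (a : F) (x : imatrix F I J) (y : imatrix F J K) :
  imulmx (a *: x) y = a *: imulmx x y.
Proof.
apply: imatrixP => i k; rewrite /imulmx imxZ.
rewrite [RHS]mulr_fsumr.
by apply: eq_fsbigr => j _; rewrite !imxE -mulrA.
Qed.

Lemma imulmxZr I J K (a : F) (x : imatrix F I J) (y : imatrix F J K) :
  imulmx x (a *: y) = a *: imulmx x y.
Proof.
apply: imatrixP => i k; rewrite /imulmx imxZ.
rewrite [RHS]mulr_fsumr.
by apply: eq_fsbigr => j _; rewrite !imxE mulrCA.
Qed.

Lemma imulmxNl I J K (x : imatrix F I J) (y : imatrix F J K) :
  imulmx (- x) y = - imulmx x y.
Proof. by rewrite -!scaleN1r imulmxZl. Qed.

Lemma imulmxNr I J K (x : imatrix F I J) (y : imatrix F J K) :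
  imulmx x (- y) = - imulmx x y.
Proof. by rewrite -!scaleN1r imulmxZr. Qed.

Lemma imul0mx I J K (x : imatrix F J K) : imulmx (0 : imatrix F I J) x = 0.
Proof. by rewrite -(scale0r (0 : imatrix F I J)) imulmxZl scale0r. Qed.

Lemma imulmx0 I J K (x : imatrix F I J) : imulmx x (0 : imatrix F J K) = 0.
Proof. by rewrite -(scale0r (0 : imatrix F J K)) imulmxZr scale0r. Qed.

Lemma imulmxA I J K L (x : imatrix F I J) (y : imatrix F J K)
    (z : imatrix F K L) :
  row_finite x -> col_finite z ->
  imulmx x (imulmx y z) = imulmx (imulmx x y) z.
Proof.
move=> xf zf; apply: imatrixP => i l.
have [s us sx] := finite_support (xf i).
have [t ut tz] := finite_support (zf l).
have yzE j : imulmx y z j l = \sum_(k <- t) y j k * z k l.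
  by apply: fsumE => // k /tz ->; rewrite mulr0.
have xyE k : imulmx x y i k = \sum_(j <- s) x i j * y j k.
  by apply: fsumE => // j /sx ->; rewrite mul0r.
rewrite [LHS](fsumE us); last by move=> j /sx ->; rewrite mul0r.
rewrite [RHS](fsumE ut); last by move=> k /tz ->; rewrite mulr0.
under eq_bigr do rewrite yzE mulr_sumr.
under [RHS]eq_bigr do rewrite xyE mulr_suml.
by rewrite exchange_big; do 2!(apply: eq_bigr => ? _); rewrite mulrA.
Qed.

Lemma finitary0 I J : finitary (0 : imatrix F I J).
Proof.
by apply: sub_finite_set (finite_set0 _) => p; rewrite /= !imxE eqxx.
Qed.

Lemma finitaryZD I J (a : F) (x y : imatrix F I J) :
  finitary x -> finitary y -> finitary (a *: x + y).
Proof.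
move=> xf yf.
apply: sub_finite_set (_ : finite_set ([set p | x p.1 p.2 != 0] `|`
  [set p | y p.1 p.2 != 0])); last by rewrite finite_setU.
move=> p /=; rewrite !imxE; have [->|_] := eqVneq (x p.1 p.2) 0; last by left.
by rewrite mulr0 add0r; right.
Qed.

Lemma finitaryM I J K (x : imatrix F I J) (y : imatrix F J K) :
  finitary x -> finitary y -> finitary (imulmx x y).
Proof.
move=> /(finite_image fst) xf /(finite_image snd) yf.
apply: sub_finite_set (finite_setX xf yf) => -[i k] /= xy0.
have [j /andP[xij yjk]] : exists j, (x i j != 0) && (y j k != 0).
  apply: contrapT => nex; move/eqP: xy0; apply; apply: fsbig1 => j _.
  apply/eqP; rewrite mulf_eq0; apply: contrapT => /negP.
  by rewrite negb_or => xy; apply: nex; exists j.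
by split; [exists (i, j)|exists (j, k)].
Qed.

End ImatrixTheory.

Section Gl.
Context (F : fieldType) (I : choiceType).

Definition finitary_pred : {pred imatrix F I I} := [pred x | `[< finitary x >]].

Lemma finitary_submod_closed : GRing.submod_closed finitary_pred.
Proof.
split; first exact/asboolP/finitary0.
by move=> a x y /asboolP xf /asboolP yf; apply/asboolP/finitaryZD.
Qed.

HB.instance Definition _ :=
  GRing.isSubmodClosed.Build F (imatrix F I I) finitary_pred
    finitary_submod_closed.

Record gl := Gl { gl_val :> imatrix F I I; gl_valP : gl_val \in finitary_pred }.

HB.instance Definition _ := [isSub for gl_val].
HB.instance Definition _ := [Choice of gl by <:].
HB.instance Definition _ := [SubChoice_isSubLmodule of gl by <:].

Lemma gl_finitary (x : gl) : finitary x.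
Proof. exact/asboolP/(valP x). Qed.

Lemma gl_row_finite (x : gl) : row_finite x.
Proof. exact/finitary_row/gl_finitary. Qed.

Lemma gl_col_finite (x : gl) : col_finite x.
Proof. exact/finitary_col/gl_finitary. Qed.

Lemma commutator_finitary (x y : gl) :
  imulmx x y - imulmx y x \in finitary_pred.
Proof.
apply: rpredB; apply/asboolP; apply: finitaryM; exact: gl_finitary.
Qed.

Definition commutator (x y : gl) : gl := Gl (commutator_finitary x y).

Lemma commutator_linearl (a : F) (x y z : gl) :
  commutator (a *: x + y) z = a *: commutator x z + commutator y z.
Proof.
apply/val_inj => /=.
rewrite imulmxDl ?imulmxDr ?imulmxZl ?imulmxZr;
  [|exact: gl_row_finite|exact: gl_col_finite].
by rewrite scalerBr opprD addrACA.
Qed.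

Lemma commutatorxx (x : gl) : commutator x x = 0.
Proof. by apply/val_inj; rewrite /= subrr. Qed.

Lemma commutatorC (x y : gl) : commutator x y = - commutator y x.
Proof. by apply/val_inj; rewrite /= opprB. Qed.

Lemma commutator_linearr (a : F) (x y z : gl) :
  commutator z (a *: x + y) = a *: commutator z x + commutator z y.
Proof.
by rewrite !(commutatorC z) commutator_linearl opprD scalerN.
Qed.

Lemma commutator_jacobi (x y z : gl) :
  commutator x (commutator y z) + commutator y (commutator z x)
    + commutator z (commutator x y) = 0.
Proof.
have E (u v w : gl) : gl_val (commutator u (commutator v w)) =
    (imulmx (imulmx u v) w - imulmx (imulmx u w) v)
    - (imulmx (imulmx v w) u - imulmx (imulmx w v) u).
  rewrite /= imulmxDr ?imulmxDl ?imulmxNl ?imulmxNr;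
    [|exact: gl_col_finite|exact: gl_row_finite].
  by rewrite !imulmxA //; apply: gl_row_finite || apply: gl_col_finite.
apply/val_inj; transitivity (gl_val (commutator x (commutator y z))
  + gl_val (commutator y (commutator z x))
  + gl_val (commutator z (commutator x y))) => //; rewrite !E.
rewrite [RHS](_ : _ = 0 :> imatrix F I I) //.
by apply: imatrixP => i j; rewrite !imxE; ring.
Qed.

HB.instance Definition _ := Lmodule_isLieAlgebra.Build F gl
  commutator_linearl commutator_linearr commutatorxx commutator_jacobi.

End Gl.

Section Classical.
Context (F : fieldType).

Lemma itraceZD (I : choiceType) (a : F) (x y : imatrix F I I) :
  finitary x -> finitary y -> itrace (a *: x + y) = a * itrace x + itrace y.
Proof.
have diag (z : imatrix F I I) : finitary z -> finite_set [set i | z i i != 0].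
  move=> /(finite_image fst); apply: sub_finite_set => i /= zi.
  by exists (i, i).
move=> /diag/finite_support[s us sx] /diag/finite_support[t ut ty].
have ust : uniq (undup (s ++ t)) by exact: undup_uniq.
have out (P : Prop) (i : I) :
    (x i i = 0 -> y i i = 0 -> P) -> i \notin undup (s ++ t) -> P.
  by rewrite mem_undup mem_cat negb_or => + /andP[/sx + /ty]; apply.
rewrite /itrace !(fsumE ust) => [|i|i|i].
- by rewrite mulr_sumr -big_split.
- by apply: out.
- by apply: out.
- by apply: out => xi yi; rewrite imxD imxZ xi yi mulr0 addr0.
Qed.

Lemma itrace_mulC (I : choiceType) (x y : gl F I) :
  itrace (imulmx x y) = itrace (imulmx y x).
Proof.
have supp (z : gl F I) : exists2 s, uniq s &
    forall i j, (i \notin s) || (j \notin s) -> gl_val z i j = 0.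
  have /finite_seqP[s sE] := gl_finitary z.
  exists (undup (map fst s ++ map snd s)); first exact: undup_uniq.
  move=> i j; apply: contraTeq => zij; rewrite !mem_undup !mem_cat.
  have ijs : (i, j) \in s by have : [set` s] (i, j) by rewrite -sE.
  by rewrite (map_f fst ijs) (map_f snd ijs) orbT.
have [s us sx] := supp x; have [t ut ty] := supp y.
have E (u v : gl F I) r : uniq r ->
    (forall i j, (i \notin r) || (j \notin r) -> gl_val u i j = 0) ->
    itrace (imulmx u v) = \sum_(i <- r) \sum_(j <- r) gl_val u i j * gl_val v j i.
  move=> ur ru; rewrite /itrace (fsumE ur) => [|i ri].
    apply: eq_bigr => i _; apply: fsumE => // j rj.
    by rewrite ru ?rj ?orbT // mul0r.
  by apply: fsbig1 => j _; rewrite ru ?ri // mul0r.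
have E' (u v : gl F I) r : uniq r ->
    (forall i j, (i \notin r) || (j \notin r) -> gl_val v i j = 0) ->
    itrace (imulmx u v) = \sum_(i <- r) \sum_(j <- r) gl_val u i j * gl_val v j i.
  move=> ur ru; rewrite /itrace (fsumE ur) => [|i ri].
    apply: eq_bigr => i _; apply: fsumE => // j rj.
    by rewrite ru ?rj ?orbT // mulr0.
  by apply: fsbig1 => j _; rewrite ru ?ri ?orbT // mulr0.
rewrite (E _ _ s) // (E' _ _ s) // exchange_big.
by do 2!(apply: eq_bigr => ? _); rewrite mulrC.
Qed.

Definition sl_set : set (gl F nat) := [set x | itrace x = 0].

Lemma sl_subspace : is_subspace sl_set.
Proof.
split; first by rewrite /sl_set /= /itrace fsbig1.
by move=> a x y /= x0 y0; rewrite /sl_set /= itraceZD ?x0 ?y0 ?mulr0 ?addr0 //;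
  exact: gl_finitary.
Qed.

Lemma sl_lie (x y : gl F nat) : sl_set x -> sl_set y -> sl_set (lie x y).
Proof.
move=> _ _; rewrite /sl_set /= addrC -scaleN1r itraceZD.
- by rewrite mulN1r itrace_mulC addNr.
- by apply: finitaryM; exact: gl_finitary.
- by apply: finitaryM; exact: gl_finitary.
Qed.

Definition sl_subalgebra : lieSubalgebra (gl F nat) :=
  LieSubalgebra sl_subspace sl_lie.

Definition sl_infty : lieAlgType F := lsa_type sl_subalgebra.

Definition o_set : set (gl F nat) :=
  [set x | itrmx x + x = 0 :> imatrix F nat nat].

Lemma o_subspace : is_subspace o_set.
Proof.
split=> [|a x y /= x0 y0]; apply: imatrixP => i j; first by rewrite !imxE addr0.
change (a * gl_val x j i + gl_val y j i + (a * gl_val x i j + gl_val y i j) = 0).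
have /(congr1 (fun z : imatrix F nat nat => z i j)) := x0.
have /(congr1 (fun z : imatrix F nat nat => z i j)) := y0.
rewrite !imxE /itrmx /= => yij xij.
by rewrite addrACA -mulrDr xij yij mulr0 addr0.
Qed.

Lemma o_lie (x y : gl F nat) : o_set x -> o_set y -> o_set (lie x y).
Proof.
rewrite /o_set /= => /addr0_eq/eqP; rewrite eqr_oppLR => /eqP xE.
move=> /addr0_eq/eqP; rewrite eqr_oppLR => /eqP yE.
have -> : itrmx (imulmx x y - imulmx y x) =
    itrmx (imulmx x y) - itrmx (imulmx y x) by [].
rewrite !itrmx_mul xE yE !imulmxNl !imulmxNr !opprK.
by rewrite addrC subrKA subrr.
Qed.

Definition o_subalgebra : lieSubalgebra (gl F nat) :=
  LieSubalgebra o_subspace o_lie.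

Definition o_infty : lieAlgType F := lsa_type o_subalgebra.

(** The block diagonal matrix with all diagonal blocks [[0, 1], [-1, 0]]; with
    indices starting at 0, the blocks sit at the pairs (2k, 2k+1). *)
Definition sp_form : imatrix F nat nat := fun i j =>
  if ~~ odd i && (j == i.+1) then 1
  else if ~~ odd j && (i == j.+1) then -1 else 0.

Lemma sp_form_row_finite : row_finite sp_form.
Proof.
move=> i; apply: sub_finite_set (finite_seq [:: i.+1; i.-1]) => j.
rewrite /= /sp_form !inE; case: (j =P i.+1) => //= _; rewrite andbF.
by case: (i =P j.+1) => [-> //= _|_]; rewrite ?eqxx // andbF eqxx.
Qed.

Lemma sp_form_col_finite : col_finite sp_form.
Proof.
move=> j; apply: sub_finite_set (finite_seq [:: j.+1; j.-1]) => i.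
rewrite /= /sp_form !inE; case: (i =P j.+1) => //= _; rewrite andbF.
by case: (j =P i.+1) => [-> //= _|_]; rewrite ?eqxx // andbF eqxx.
Qed.

Definition sp_set : set (gl F nat) :=
  [set x | imulmx (itrmx x) sp_form + imulmx sp_form x = 0].

Lemma sp_subspace : is_subspace sp_set.
Proof.
split=> [|a x y /= x0 y0].
  change (imulmx (0 : imatrix F nat nat) sp_form +
    imulmx sp_form (0 : imatrix F nat nat) = 0).
  by rewrite imul0mx imulmx0 addr0.
rewrite /sp_set /=.
have -> : itrmx (a *: gl_val x + gl_val y) = a *: itrmx x + itrmx y by [].
rewrite imulmxDl ?imulmxDr ?imulmxZl ?imulmxZr;
  [|exact: sp_form_row_finite|exact: sp_form_col_finite].
by rewrite addrACA -scalerDr x0 y0 scaler0 addr0.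
Qed.

Lemma sp_lie (x y : gl F nat) : sp_set x -> sp_set y -> sp_set (lie x y).
Proof.
rewrite /sp_set /= => /eqP; rewrite addr_eq0 => /eqP xE.
move=> /eqP; rewrite addr_eq0 => /eqP yE.
have -> : itrmx (imulmx x y - imulmx y x) =
    itrmx (imulmx x y) - itrmx (imulmx y x) by [].
have xr := gl_row_finite x; have xc := gl_col_finite x.
have yr := gl_row_finite y; have yc := gl_col_finite y.
have xtr : row_finite (itrmx x) by exact/finitary_row/finitary_tr/gl_finitary.
have ytr : row_finite (itrmx y) by exact/finitary_row/finitary_tr/gl_finitary.
have Jr := sp_form_row_finite; have Jc := sp_form_col_finite.
rewrite imulmxDl // imulmxDr // imulmxNl imulmxNr !itrmx_mul.
rewrite -!imulmxA // xE yE !imulmxNr !imulmxA // xE yE !imulmxNl !opprK.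
by rewrite addrC subrKA subrr.
Qed.

Definition sp_subalgebra : lieSubalgebra (gl F nat) :=
  LieSubalgebra sp_subspace sp_lie.

Definition sp_infty : lieAlgType F := lsa_type sp_subalgebra.

End Classical.

(** Rows and columns of a matrix with four infinite blocks are indexed by
    [nat + nat]. *)

Section Blocks.
Context (F : fieldType).
Implicit Types x : imatrix F (nat + nat)%type (nat + nat)%type.

Definition blk_ul x : imatrix F nat nat := fun i j => x (inl i) (inl j).
Definition blk_ur x : imatrix F nat nat := fun i j => x (inl i) (inr j).
Definition blk_dl x : imatrix F nat nat := fun i j => x (inr i) (inl j).
Definition blk_dr x : imatrix F nat nat := fun i j => x (inr i) (inr j).

Definition o_block_set : set (gl F (nat + nat)%type) :=
  [set x | [/\ blk_dr x = - itrmx (blk_ul x),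
               itrmx (blk_ur x) = - blk_ur x
             & itrmx (blk_dl x) = - blk_dl x]].

Definition sp_block_set : set (gl F (nat + nat)%type) :=
  [set x | [/\ blk_dr x = - itrmx (blk_ul x),
               itrmx (blk_ur x) = blk_ur x
             & itrmx (blk_dl x) = blk_dl x]].

Definition blk_swap (i : nat + nat) : nat + nat :=
  match i with inl k => inr k | inr k => inl k end.

Definition blk_sign (e : F) (i : nat + nat) : F := if i is inl _ then 1 else e.

Lemma o_block_setP (x : gl F (nat + nat)%type) : o_block_set x <->
  forall i j, gl_val x (blk_swap j) (blk_swap i) =
    - (blk_sign 1 i * blk_sign 1 j * gl_val x i j).
Proof.
split=> [[dr ur dl] [i|i] [j|j]|h]; rewrite /= ?mulr1 ?mul1r.
- exact: (congr1 (fun z : imatrix F nat nat => z j i) dr).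
- exact: (congr1 (fun z : imatrix F nat nat => z i j) ur).
- exact: (congr1 (fun z : imatrix F nat nat => z i j) dl).
- by apply/eqP; rewrite -eqr_oppLR; apply/eqP/esym;
    exact: (congr1 (fun z : imatrix F nat nat => z i j) dr).
split; apply: imatrixP => i j; rewrite imxN.
- by have := h (inl j) (inl i); rewrite /= !mul1r.
- by have := h (inl i) (inr j); rewrite /= !mul1r.
- by have := h (inr i) (inl j); rewrite /= !mul1r.
Qed.

Lemma sp_block_setP (x : gl F (nat + nat)%type) : sp_block_set x <->
  forall i j, gl_val x (blk_swap j) (blk_swap i) =
    - (blk_sign (-1) i * blk_sign (-1) j * gl_val x i j).
Proof.
split=> [[dr ur dl] [i|i] [j|j]|h]; rewrite /= ?mulr1 ?mul1r ?mulrNN ?mul1r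
  ?mulN1r ?opprK.
- exact: (congr1 (fun z : imatrix F nat nat => z j i) dr).
- exact: (congr1 (fun z : imatrix F nat nat => z i j) ur).
- exact: (congr1 (fun z : imatrix F nat nat => z i j) dl).
- by apply/eqP; rewrite -eqr_oppLR; apply/eqP/esym;
    exact: (congr1 (fun z : imatrix F nat nat => z i j) dr).
split; apply: imatrixP => i j; rewrite ?imxN.
- by have := h (inl j) (inl i); rewrite /= !mul1r.
- by have := h (inl i) (inr j); rewrite /= !(mul1r, mulr1, mulN1r, opprK).
- by have := h (inr i) (inl j); rewrite /= !(mul1r, mulr1, mulN1r, opprK).
Qed.

Lemma blk_lie (e : F) (x y : gl F (nat + nat)%type) : e * e = 1 ->
  (forall i j, gl_val x (blk_swap j) (blk_swap i) =
    - (blk_sign e i * blk_sign e j * gl_val x i j)) ->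
  (forall i j, gl_val y (blk_swap j) (blk_swap i) =
    - (blk_sign e i * blk_sign e j * gl_val y i j)) ->
  forall i j, gl_val (lie x y) (blk_swap j) (blk_swap i) =
    - (blk_sign e i * blk_sign e j * gl_val (lie x y) i j).
Proof.
move=> ee xE yE i j.
have swapK : involutive blk_swap by case.
have sgn k : blk_sign e k * blk_sign e k = 1 by case: k => ?; rewrite /= ?mulr1.
have M (u v : gl F (nat + nat)%type) :
    (forall i j, gl_val u (blk_swap j) (blk_swap i) =
      - (blk_sign e i * blk_sign e j * gl_val u i j)) ->
    (forall i j, gl_val v (blk_swap j) (blk_swap i) =
      - (blk_sign e i * blk_sign e j * gl_val v i j)) ->
    imulmx u v (blk_swap j) (blk_swap i) =
      blk_sign e i * blk_sign e j * imulmx v u i j.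
  move=> uE vE; rewrite /imulmx mulr_fsumr.
  rewrite (reindex_fsbigT blk_swap); last exact: inv_bij.
  apply: eq_fsbigr => k _; rewrite uE vE mulrNN.
  rewrite -[RHS]mul1r -(sgn k); ring.
by rewrite /= !imxE !M // -mulrBr -mulrN opprB.
Qed.

Lemma o_block_subspace : is_subspace o_block_set.
Proof.
split=> [|a x y /o_block_setP xE /o_block_setP yE]; apply/o_block_setP => i j.
  by rewrite /= mulr0 oppr0.
by rewrite /= !imxE xE yE; ring.
Qed.

Lemma sp_block_subspace : is_subspace sp_block_set.
Proof.
split=> [|a x y /sp_block_setP xE /sp_block_setP yE]; apply/sp_block_setP => i j.
  by rewrite /= mulr0 oppr0.
by rewrite /= !imxE xE yE; ring.
Qed.

Lemma o_block_lie (x y : gl F (nat + nat)%type) :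
  o_block_set x -> o_block_set y -> o_block_set (lie x y).
Proof.
move=> /o_block_setP xE /o_block_setP yE; apply/o_block_setP.
by apply: blk_lie => //; rewrite mulr1.
Qed.

Lemma sp_block_lie (x y : gl F (nat + nat)%type) :
  sp_block_set x -> sp_block_set y -> sp_block_set (lie x y).
Proof.
move=> /sp_block_setP xE /sp_block_setP yE; apply/sp_block_setP.
by apply: blk_lie => //; rewrite mulrNN mulr1.
Qed.

Definition o_block_subalgebra : lieSubalgebra (gl F (nat + nat)%type) :=
  LieSubalgebra o_block_subspace o_block_lie.

Definition o_block : lieAlgType F := lsa_type o_block_subalgebra.

Definition sp_block_subalgebra : lieSubalgebra (gl F (nat + nat)%type) :=
  LieSubalgebra sp_block_subspace sp_block_lie.

Definition sp_block : lieAlgType F := lsa_type sp_block_subalgebra.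

End Blocks.

Definition restrict (F : fieldType) (L : lieAlgType F) (S : lieSubalgebra L)
    (A : set L) : set (lsa_type S) := [set x | A (lsa_val x)].

(** The components -1, 0, 1 consist of the matrices vanishing outside the
    lower left, diagonal, upper right blocks respectively, for the splitting of
    the indices into the first [n] and the others.  The condition
    tr a + tr d = 0 on the component 0 is membership in [sl_infty]. *)
Definition sl_grading (F : fieldType) (n : nat) : int -> set (sl_infty F) :=
  components3
    (restrict [set x | forall i j, ~~ ((n <= i)%N && (j < n)%N) -> gl_val x i j = 0])
    (restrict [set x | forall i j, (i < n)%N != (j < n)%N -> gl_val x i j = 0])
    (restrict [set x | forall i j, ~~ ((i < n)%N && (n <= j)%N) -> gl_val x i j = 0]).
Arguments sl_grading : clear implicits.

Section BlockGrading.
Context {F : fieldType}.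
Local Notation glb := (gl F (nat + nat)%type).

Definition blk_lower : set glb :=
  [set x | [/\ blk_ul x = 0, blk_ur x = 0 & blk_dr x = 0]].
Definition blk_diag : set glb := [set x | blk_ur x = 0 /\ blk_dl x = 0].
Definition blk_upper : set glb :=
  [set x | [/\ blk_ul x = 0, blk_dl x = 0 & blk_dr x = 0]].

End BlockGrading.

Definition o_block_grading (F : fieldType) : int -> set (o_block F) :=
  components3 (restrict blk_lower) (restrict blk_diag) (restrict blk_upper).
Arguments o_block_grading : clear implicits.

Definition sp_block_grading (F : fieldType) : int -> set (sp_block F) :=
  components3 (restrict blk_lower) (restrict blk_diag) (restrict blk_upper).
Arguments sp_block_grading : clear implicits.

(** [P] and [Q] are mutually inverse.  Finiteness of the columns makes them
    endomorphisms of the space of finitely supported column vectors;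
    finiteness of the rows makes conjugation preserve finitary matrices. *)
Definition change_of_basis (F : fieldType) (I J : choiceType)
    (P : imatrix F I J) (Q : imatrix F J I) : Prop :=
  [/\ row_finite P /\ col_finite P, row_finite Q /\ col_finite Q,
      imulmx P Q = imx1 & imulmx Q P = imx1].

Definition basis_change_isomorphism (F : fieldType) (I J : choiceType)
    (S : lieSubalgebra (gl F I)) (T : lieSubalgebra (gl F J))
    (phi : lsa_type S -> lsa_type T) : Prop :=
  lie_isomorphism phi /\
  exists (P : imatrix F I J) (Q : imatrix F J I), change_of_basis P Q /\
    forall x, lsa_val (phi x) = imulmx Q (imulmx (lsa_val x) P) :> imatrix F J J.

Definition transported_grading (F : fieldType) (L M : lieAlgType F)
    (phi : L -> M) (G : int -> set M) : int -> set L :=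
  fun i => phi @^-1` G i.

(* Main.v *)
From mathcomp Require Import all_boot all_order all_algebra.
From mathcomp Require Import boolp classical_sets functions cardinality fsbigop.
From mathcomp Require Import ring zify.
Require Import Defs.

Set Implicit Arguments.
Unset Strict Implicit.
Unset Printing Implicit Defensive.

Import GRing.Theory.

(** The idea is to evaluate (ad_x)^2 on (combinations of) matrix units.  If [x]
    is finitary and [e_ij] is a matrix unit, then the entry of
      [x, [x, e_ij]] = x^2 e_ij - 2 x e_ij x + e_ij x^2
    at (a, b) is
      (x^2)_ai delta_jb - 2 x_ai x_jb + delta_ai (x^2)_jb.
    Because the matrices are infinite and [x] is finitary, there is an index [n]
    whose row and column in [x] are zero.  Taking j = b = n isolates the first
    term and gives x^2 = 0, which leaves x y x = 0 for all [y] in the algebra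
    (characteristic 2 being excluded).  Looking at rank one choices of [y] then
    kills every entry of [x].
    - For sl, the units [e_ij] with i <> j suffice
      ([off_diagonal_nondegenerate]).
    - The orthogonal and symplectic algebras are instances of one family: the
      skew elements z = - z* for the adjoint
      (z* )_ij = s_i s_j z_(sigma j, sigma i) of the form that pairs [i] with
      [sigma i], where [sigma] is an involution of the indices and [s] a sign
      with s_(sigma i) = eps s_i.  Orthogonal algebras have eps = 1, symplectic
      ones have eps = -1.  Here y runs over the elements e_ij - (e_ij)*
      ([skew_nondegenerate]).

    Graded strong nondegeneracy is a formal consequence, once the three
    components are known to form a grading.  In all cases the index set is cut in
    two by a predicate [p], and the component of degree [k] consists of the
    matrices supported on the positions (i, j) with p(i) - p(j) = k.  This makes
    the grading axioms immediate, as soon as the algebra is stable under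
    truncation to each degree ([homogeneous_3grading]).  Gradings are carried
    along isomorphisms ([transported_3grading]).

    Finally, the isomorphisms with the block forms come from congruences of
    bilinear forms: if P^t B P = C, then x |-> P^-1 x P maps the skew elements of
    [B] to those of [C] ([congruent_forms_isomorphism]).  All the forms involved,
    and the matrices [P], are block diagonal with equal 2 x 2 blocks, so only
    identities between 2 x 2 matrices remain ([blockdiag_isomorphism]).  In the
    orthogonal case, two orthonormal vectors are replaced by a hyperbolic pair of
    isotropic vectors, which is where a square root of -1 is used. *)

(** * Double brackets with matrix units *)

Section MatrixUnits.
Local Open Scope classical_set_scope.
Local Open Scope ring_scope.
Context {F : fieldType} {I : choiceType}.

Lemma fsum_unique (T : choiceType) (t : T) (f : T -> F) :
  (forall i, i != t -> f i = 0) -> \sum_(i \in [set: T]) f i = f t.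
Proof.
by move=> f0; rewrite (@fsumE _ _ [:: t]) ?big_seq1 // => i; rewrite inE => /f0.
Qed.

Lemma fsum_pair (T : choiceType) (s t : T) (f : T -> F) : s != t ->
  (forall i, i != s -> i != t -> f i = 0) ->
  \sum_(i \in [set: T]) f i = f s + f t.
Proof.
move=> st f0; rewrite (@fsumE _ _ [:: s; t]) ?big_cons ?big_nil ?addr0 //=.
  by rewrite inE st.
by move=> i; rewrite !inE negb_or => /andP[/f0]; apply.
Qed.

Definition unit_imx (i j : I) : imatrix F I I :=
  fun a b => ((a == i) && (b == j))%:R.

Lemma unit_imx_finitary i j : unit_imx i j \in @finitary_pred F I.
Proof.
apply/asboolP; apply: sub_finite_set (finite_set1 (i, j)) => -[a b] /=.
rewrite /unit_imx; have [->|] := eqVneq a i; last by rewrite eqxx.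
by have [->|] := eqVneq b j; rewrite ?eqxx.
Qed.

Definition gl_unit i j : gl F I := Gl (unit_imx_finitary i j).

Lemma glZD (c : F) (x y : gl F I) i j :
  gl_val (c *: x + y) i j = c * gl_val x i j + gl_val y i j.
Proof. by []. Qed.

Lemma imulmx_unitr (x : imatrix F I I) i j a b :
  imulmx x (unit_imx i j) a b = x a i * (b == j)%:R.
Proof.
rewrite /imulmx (fsum_unique (t := i)) => [|k /negbTE ki].
  by rewrite /unit_imx eqxx.
by rewrite /unit_imx ki mulr0.
Qed.

Lemma imulmx_unitl (x : imatrix F I I) i j a b :
  imulmx (unit_imx i j) x a b = (a == i)%:R * x j b.
Proof.
rewrite /imulmx (fsum_unique (t := j)) => [|k /negbTE kj].
  by rewrite /unit_imx eqxx andbT.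
by rewrite /unit_imx kj andbF mul0r.
Qed.

Lemma lie_lieE (x y : gl F I) : gl_val (lie x (lie x y)) =
  imulmx (imulmx x x) y - 2 *: imulmx x (imulmx y x) + imulmx y (imulmx x x).
Proof.
have xr := gl_row_finite x; have xc := gl_col_finite x.
have yr := gl_row_finite y; have yc := gl_col_finite y.
rewrite /= imulmxDr // imulmxDl // imulmxNr imulmxNl -!imulmxA //.
by apply: imatrixP => i j; rewrite !imxE; ring.
Qed.

(** The formula behind all the nondegeneracy proofs: the outer terms see [x ^ 2]
    in one row or column only, the middle one is a rank one product. *)
Lemma lie_lie_unit (x : gl F I) i j a b :
  gl_val (lie x (lie x (gl_unit i j))) a b =
  imulmx x x a i * (b == j)%:R - 2 * (gl_val x a i * gl_val x j b)
    + (a == i)%:R * imulmx x x j b.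
Proof.
rewrite lie_lieE !imxE imulmx_unitr imulmx_unitl; congr (_ - 2 * _ + _).
rewrite /imulmx (fsum_unique (t := i)) => [|k /negbTE ki].
  by have := imulmx_unitl x i j i b; rewrite /imulmx => ->; rewrite eqxx mul1r.
have := imulmx_unitl x i j k b; rewrite /imulmx => ->.
by rewrite ki mul0r mulr0.
Qed.

(** This is where infinite matrices are easier than finite ones: at a row and
    column of zeros, the formula for the double bracket reduces to one term. *)
Lemma finitary_avoid (x : imatrix F I I) : infinite_set [set: I] -> finitary x ->
  exists n, (forall i, x i n = 0) /\ (forall i, x n i = 0).
Proof.
move=> Iinf xf.
have := finite_image fst xf; have := finite_image snd xf.
set A := _ @` _; set B := _ @` _ => Af Bf.
have [n nAB] : exists n, ~ (A `|` B) n; last first.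
  exists n; split=> i; apply/eqP/negPn/negP => xin; apply: nAB.
    by left; exists (i, n).
  by right; exists (n, i).
apply: contrapT => h; apply: Iinf.
apply: sub_finite_set (_ : finite_set (A `|` B)); last by rewrite finite_setU.
by move=> n _; apply: contrapT => nAB; apply: h; exists n.
Qed.

Lemma nondegenerate_subalgebra (S : lieSubalgebra (gl F I)) :
  (forall x : gl F I, lsa_set S x ->
     (forall y, lsa_set S y -> lie x (lie x y) = 0) -> gl_val x = 0) ->
  strongly_nondegenerate (lsa_type S).
Proof.
move=> h x x0; apply/val_inj/val_inj; apply: h => [|y Sy].
  exact/asboolP/(valP x).
have Sy' : y \in lsa_pred S by apply/asboolP.
have /(congr1 (@lsa_val _ _ S)) := x0 (LsaType Sy').
by move=> h; exact: h.
Qed.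

End MatrixUnits.

(** * The special linear algebra *)

Section Special.
Local Open Scope classical_set_scope.
Local Open Scope ring_scope.
Context {F : fieldType} (two_neq0 : 2 != 0 :> F).

(** After [x ^ 2 = 0], the rank one term gives x_ai x_jb = 0 for i <> j.  So a
    nonzero entry x_ai forces all rows but the [i]-th to vanish; hence a = i, and
    then (x ^ 2)_ii is the square of x_ii. *)
Lemma off_diagonal_nondegenerate (I : choiceType) (x : gl F I) :
  infinite_set [set: I] ->
  (forall i j, i != j -> lie x (lie x (gl_unit i j)) = 0) -> gl_val x = 0.
Proof.
move=> Iinf x0.
have ad2 i j a b : i != j ->
    imulmx x x a i * (b == j)%:R - 2 * (gl_val x a i * gl_val x j b)
    + (a == i)%:R * imulmx x x j b = 0.
  by move=> /x0 h; rewrite -lie_lie_unit h.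
have [n [xn nx]] := finitary_avoid Iinf (gl_finitary x).
have sq0 a i : imulmx x x a i = 0.
  have [->|/(ad2 i n a n)] := eqVneq i n.
    by rewrite /imulmx fsbig1 // => k _; rewrite xn mulr0.
  have -> : imulmx x x n n = 0.
    by rewrite /imulmx fsbig1 // => k _; rewrite xn mulr0.
  by rewrite eqxx nx mulr1 !mulr0 subr0 addr0.
have xx0 a i j b : i != j -> gl_val x a i * gl_val x j b = 0.
  move=> /(ad2 i j a b)/eqP; rewrite !sq0 mul0r mulr0 addr0 sub0r oppr_eq0 mulf_eq0.
  by rewrite (negbTE two_neq0) => /eqP.
apply: imatrixP => a i; apply/eqP/negPn/negP => xai.
have row0 j b : j != i -> gl_val x j b = 0.
  rewrite eq_sym => /(xx0 a i j b)/eqP; rewrite mulf_eq0.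
  by move: xai => /negbTE -> /eqP.
have ai : a = i by apply/eqP/negPn/negP => /row0-/(_ i) xai0; rewrite xai0 eqxx in xai.
have := sq0 i i; rewrite /imulmx (fsum_unique (t := i)) => [/eqP|k /row0 ->].
  by rewrite mulf_eq0 orbb -{1}ai; apply/negP.
by rewrite mulr0.
Qed.

Lemma sl_nondegenerate : strongly_nondegenerate (sl_infty F).
Proof.
apply: nondegenerate_subalgebra => x _ x0.
apply: off_diagonal_nondegenerate infinite_nat _ => i j ij.
apply: x0; rewrite /= /sl_set /= /itrace fsbig1 // => k _.
by rewrite /unit_imx; case: eqP => //= ->; rewrite (negbTE ij).
Qed.

End Special.

(** * Algebras of skew elements *)

Section SignedInvolutions.
Local Open Scope classical_set_scope.
Local Open Scope ring_scope.

(** The data of a monomial bilinear form <e_i, e_(sigma i)> = s_i that is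
    symmetric (eps = 1) or alternating (eps = -1). *)
Record signedInvolution (F : fieldType) (I : choiceType) := SignedInvolution {
  sact : I -> I;
  ssgn : I -> F;
  seps : F;
  sactK : involutive sact;
  ssgn2 : forall i, ssgn i * ssgn i = 1;
  ssgn_act : forall i, ssgn (sact i) = seps * ssgn i;
  seps_pm : seps = 1 \/ seps = -1 }.

Context {F : fieldType} {I : choiceType} (s : signedInvolution F I).

Lemma ssgn_neq0 i : ssgn s i != 0.
Proof.
by apply/eqP => h; have /eqP := ssgn2 s i; rewrite h mul0r eq_sym oner_eq0.
Qed.

Lemma seps2 : seps s * seps s = 1.
Proof. by case: (seps_pm s) => ->; rewrite ?mulrNN mulr1. Qed.

(** The entrywise form of x = - x*, for the adjoint with respect to the form;
    see [skew_monomialP]. *)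
Definition skew_entries (x : imatrix F I I) : Prop := forall i j,
  x (sact s j) (sact s i) = - (ssgn s i * ssgn s j * x i j).

Definition skew_form (J : choiceType) (B : imatrix F J J) (x : imatrix F J J) : Prop :=
  imulmx (itrmx x) B + imulmx B x = 0.

Definition monomial : imatrix F I I := fun i j => if j == sact s i then ssgn s i else 0.

(** A monomial form [B] merely permutes and rescales rows and columns, so
    that x^t B + B x is, up to signs, the matrix of the relations between
    entries. *)
Lemma skew_monomialP (x : imatrix F I I) :
  skew_form monomial x <-> skew_entries x.
Proof.
have E i j : (imulmx (itrmx x) monomial + imulmx monomial x) (sact s i) j =
    seps s * ssgn s j * (x (sact s j) (sact s i) + ssgn s i * ssgn s j * x i j).
  rewrite imxE /imulmx (fsum_unique (t := sact s j)) => [|k /negbTE kj].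
    rewrite (fsum_unique (t := i)) => [|k /negbTE ki]; last first.
      by rewrite /monomial sactK ki mul0r.
    rewrite /monomial !sactK !eqxx !ssgn_act mulrDr /itrmx.
    transitivity (seps s * ssgn s j * x (sact s j) (sact s i) +
      seps s * ssgn s i * (ssgn s j * ssgn s j) * x i j); last by ring.
    by rewrite ssgn2; ring.
  rewrite /monomial (_ : j == _ = false) ?mulr0 //.
  by apply/eqP => jk; rewrite jk sactK eqxx in kj.
have u j : seps s * ssgn s j != 0 by rewrite -ssgn_act ssgn_neq0.
split=> [h i j|h].
  have := E i j; rewrite h imxE => /esym/eqP; rewrite mulf_eq0 (negbTE (u j)) /=.
  by rewrite addr_eq0 => /eqP.
by apply: imatrixP => i j; rewrite -(sactK s i) E h addNr mulr0.
Qed.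

(** With y = e_ij - (e_ij)*, the hypothesis says that the double bracket with
    [e_ij] equals the one with (e_ij)* = s_i s_j e_(sigma j, sigma i).  Taking
    j = n with zero row and column [n], hence zero row and column [sigma n], gives
    x ^ 2 = 0 and then
      x_ai x_jb = s_i s_j x_(a, sigma j) x_(sigma i, b).
    If eps = 1, the entries x_(k, sigma k) vanish by skewness, and j = a, b = i
    gives x_ai ^ 2 = 0.  If eps = -1, these entries may survive, but j = sigma i
    and b = sigma a give x_ai ^ 2 = - x_ai ^ 2. *)
Lemma skew_nondegenerate (S : lieSubalgebra (gl F I)) : 2 != 0 :> F ->
  infinite_set [set: I] -> (forall x, lsa_set S x <-> skew_entries (gl_val x)) ->
  strongly_nondegenerate (lsa_type S).
Proof.
move=> two_neq0 Iinf SE; apply: nondegenerate_subalgebra => x /SE xE x0.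
have ad2 i j a b :
    imulmx x x a i * (b == j)%:R - 2 * (gl_val x a i * gl_val x j b)
      + (a == i)%:R * imulmx x x j b =
    ssgn s i * ssgn s j *
    (imulmx x x a (sact s j) * (b == sact s i)%:R
     - 2 * (gl_val x a (sact s j) * gl_val x (sact s i) b)
     + (a == sact s j)%:R * imulmx x x (sact s i) b).
  rewrite -!lie_lie_unit.
  (* e_ij minus its adjoint, which is skew since the adjoint is involutive *)
  pose y := - (ssgn s i * ssgn s j) *: gl_unit (sact s j) (sact s i)
    + gl_unit i j : gl F I.
  have Sy : lsa_set S y.
    apply/SE => k l; rewrite /y /= !imxE /unit_imx.
    rewrite !(inv_eq (@sactK _ _ s)) !sactK ![(l == _) && _]andbC.
    have A : ((k == i) && (l == j))%:R * (ssgn s k * ssgn s l) =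
        ((k == i) && (l == j))%:R * (ssgn s i * ssgn s j) :> F.
      by case: eqP => [->|_]; case: eqP => [->|_]; rewrite ?mul0r.
    have B : ((k == sact s j) && (l == sact s i))%:R * (ssgn s k * ssgn s l) *
        (ssgn s i * ssgn s j) = ((k == sact s j) && (l == sact s i))%:R :> F.
      case: eqP => [->|_]; case: eqP => [->|_]; rewrite ?mul0r //= !ssgn_act.
      transitivity (seps s * seps s * (ssgn s i * ssgn s i) *
        (ssgn s j * ssgn s j)); first by ring.
      by rewrite seps2 !ssgn2 !mulr1.
    rewrite -[X in _ + X = _]B.
    transitivity (- (((k == i) && (l == j))%:R * (ssgn s i * ssgn s j)) +
      ((k == sact s j) && (l == sact s i))%:R * (ssgn s k * ssgn s l) *
        (ssgn s i * ssgn s j)); first by ring.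
    by rewrite -A; ring.
  have := x0 y Sy; rewrite /y !lie_linearr => /(congr1 (fun z => gl_val z a b)).
  rewrite glZD mulNr addrC => /eqP; rewrite subr_eq0 => /eqP.
  exact.
have eq_opp0 (t : F) : t = - t -> t = 0.
  move=> /eqP; rewrite -subr_eq0 opprK -mulr2n -mulr_natl mulf_eq0.
  by rewrite (negbTE two_neq0) => /eqP.
have [n [xn nx]] := finitary_avoid Iinf (gl_finitary x).
have xn' i : gl_val x i (sact s n) = 0.
  by rewrite -(sactK s i) xE nx mulr0 oppr0.
have sq0 a i : imulmx x x a i = 0.
  have := ad2 i n a n; rewrite nx eqxx mulr1 mulr0 mulr0 subr0.
  have -> : imulmx x x n n = 0.
    by rewrite /imulmx fsbig1 // => k _; rewrite xn mulr0.
  have -> : imulmx x x a (sact s n) = 0.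
    by rewrite /imulmx fsbig1 // => k _; rewrite xn' mulr0.
  have -> : imulmx x x (sact s i) n = 0.
    by rewrite /imulmx fsbig1 // => k _; rewrite xn mulr0.
  by rewrite xn' xn !mul0r !mulr0 addr0 subr0 addr0 mulr0.
have rank1 i j a b : gl_val x a i * gl_val x j b =
    ssgn s i * ssgn s j * (gl_val x a (sact s j) * gl_val x (sact s i) b).
  have := ad2 i j a b; rewrite !sq0 !(mul0r, mulr0, add0r, addr0, sub0r).
  rewrite mulrN => /oppr_inj; rewrite [RHS]mulrCA => h; exact: mulfI two_neq0 _ _ h.
apply: imatrixP => a i; rewrite imxE; case: (seps_pm s) => epsE.
  have diag0 k : gl_val x k (sact s k) = 0.
    have := xE k (sact s k); rewrite sactK ssgn_act epsE mul1r ssgn2 mul1r.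
    exact: eq_opp0.
  have diag0' : gl_val x (sact s i) i = 0 by rewrite -[X in gl_val x _ X](sactK s).
  apply/eqP; have /eqP := rank1 i a a i.
  by rewrite diag0' !mulr0 mulf_eq0 orbb.
apply/eqP; have /eqP := rank1 i (sact s i) a (sact s a).
rewrite sactK ssgn_act epsE xE.
rewrite (_ : ssgn s i * _ = -1); last by rewrite mulrCA ssgn2; ring.
rewrite mulN1r => /eqP/eq_opp0/eqP; rewrite // !mulf_eq0 oppr_eq0 !mulf_eq0.
by rewrite !(negbTE (ssgn_neq0 _)) /= orbb.
Qed.

End SignedInvolutions.

(** * Gradings by the position of the nonzero entries *)

Section Gradings.
Local Open Scope classical_set_scope.
Local Open Scope ring_scope.

Section Weights.
Context {F : fieldType} {I : choiceType} (p : pred I).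

(** The degree of the matrix unit [e_ij]: additive along products, and always
    -1, 0 or 1. *)
Definition wt (i j : I) : int := (p i : nat)%:Z - (p j : nat)%:Z.

Definition homogeneous (k : int) : set (gl F I) :=
  [set x | forall i j, wt i j != k -> gl_val x i j = 0].

Definition proj_imx (k : int) (x : gl F I) : imatrix F I I :=
  fun i j => if wt i j == k then gl_val x i j else 0.

Lemma proj_finitary k x : proj_imx k x \in @finitary_pred F I.
Proof.
apply/asboolP; apply: sub_finite_set (gl_finitary x) => -[i j] /=.
by rewrite /proj_imx; case: ifP; rewrite ?eqxx.
Qed.

Definition proj k x : gl F I := Gl (proj_finitary k x).

Lemma glP (x y : gl F I) : (forall i j, gl_val x i j = gl_val y i j) -> x = y.
Proof. by move=> xy; apply/val_inj/imatrixP. Qed.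

Lemma glD (x y : gl F I) i j :
  gl_val (x + y) i j = gl_val x i j + gl_val y i j.
Proof. by []. Qed.

Lemma homogeneous_proj k x : homogeneous k (proj k x).
Proof. by move=> i j /negbTE h; rewrite /= /proj_imx h. Qed.

Lemma homogeneous_subspace k : is_subspace (homogeneous k).
Proof.
split=> [i j //|a x y xk yk i j ijk]; rewrite glZD xk // yk // mulr0 addr0 //.
Qed.

Lemma homogeneous_lie k l x y :
  homogeneous k x -> homogeneous l y -> homogeneous (k + l) (lie x y).
Proof.
have M u v k' l' a b : homogeneous k' u -> homogeneous l' v ->
    wt a b != k' + l' -> imulmx u v a b = 0.
  move=> uk vl ab; rewrite /imulmx fsbig1 // => c _.
  have [ac|/uk ->] := eqVneq (wt a c) k'; last by rewrite mul0r.
  rewrite vl ?mulr0 //; apply: contra ab => /eqP <-.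
  by rewrite -ac /wt addrA subrK.
move=> xk yl i j ij; rewrite /= imxD imxN.
by rewrite (M _ _ _ _ _ _ xk yl) // (M _ _ _ _ _ _ yl xk) ?subr0 // addrC.
Qed.

Lemma wt_inset i j : wt i j \in [:: -1; 0; 1].
Proof. by rewrite /wt !inE; case: (p i); case: (p j). Qed.

Lemma homogeneous_outside k : k \notin [:: -1; 0; 1] -> homogeneous k = [set 0].
Proof.
move=> kN; apply/seteqP; split=> [x xk|x -> //]; apply: glP => i j.
by rewrite xk //; apply: contra kN => /eqP <-; exact: wt_inset.
Qed.

Lemma sum_proj x : x = proj (-1) x + proj 0 x + proj 1 x.
Proof.
apply: glP => i j; rewrite !glD /= /proj_imx.
have := wt_inset i j; rewrite !inE.
by move=> /or3P[] /eqP -> /=; rewrite ?addr0 ?add0r.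
Qed.

(** Reads off the three summands of a decomposition, whence its uniqueness. *)
Lemma proj_sum x y z k : homogeneous (-1) x -> homogeneous 0 y -> homogeneous 1 z ->
  proj k (x + y + z) =
  if k == -1 then x else if k == 0 then y else if k == 1 then z else 0.
Proof.
move=> hx hy hz; apply: glP => i j.
rewrite [LHS](_ : _ = if wt i j == k
  then gl_val x i j + gl_val y i j + gl_val z i j else 0) //.
have := wt_inset i j; rewrite !inE => ij.
have [->|/negbTE k1] := eqVneq k (-1).
  by case: ifP => [/eqP h|/negbT/hx //]; rewrite hy ?hz ?h // !addr0.
have [->|/negbTE k0] := eqVneq k 0.
  by case: ifP => [/eqP h|/negbT/hy //]; rewrite hx ?hz ?h // add0r addr0.
have [->|/negbTE k2] := eqVneq k 1.
  by case: ifP => [/eqP h|/negbT/hz //]; rewrite hx ?hy ?h // !add0r.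
by case: eqP => // h; move: ij; rewrite h k1 k0 k2.
Qed.

(** Identifies three explicitly given components with those of one uniform
    family, so that the axioms need not be checked pair by pair. *)
Lemma components3_homogeneous (S : lieSubalgebra (gl F I)) (A B C : set (gl F I)) :
  (forall x, A x <-> homogeneous (-1) x) -> (forall x, B x <-> homogeneous 0 x) ->
  (forall x, C x <-> homogeneous 1 x) ->
  components3 (restrict A : set (lsa_type S)) (restrict B) (restrict C) =
  fun k => restrict (homogeneous k).
Proof.
move=> AE BE CE; apply/funext => k; rewrite /components3.
have [->|k1] := eqVneq k (-1); first by apply/seteqP; split=> x /AE.
have [->|k0] := eqVneq k 0; first by apply/seteqP; split=> x /BE.
have [->|k2] := eqVneq k 1; first by apply/seteqP; split=> x /CE.
rewrite /restrict homogeneous_outside ?inE ?negb_or ?k1 ?k0 ?k2 //.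
by apply/seteqP; split=> x => [->//|h]; exact/val_inj.
Qed.

(** The whole algebra of finitary matrices is graded by degree; a subalgebra
    inherits the grading when it contains the homogeneous parts of its
    elements. *)
Lemma homogeneous_3grading (S : lieSubalgebra (gl F I)) :
  (forall k x, lsa_set S x -> lsa_set S (proj k x)) ->
  is_3grading (fun k => restrict (homogeneous k) : set (lsa_type S)).
Proof.
move=> Sproj; split.
- move=> k; have [h0 hD] := homogeneous_subspace k.
  by split=> [|a x y]; [exact: h0 | exact: hD].
- move=> k kN; rewrite /restrict homogeneous_outside //.
  by apply/seteqP; split=> x => [h|->//]; exact/val_inj.
- move=> x.
  have projS k : proj k (lsa_val x) \in lsa_pred S.
    by apply/asboolP/Sproj/asboolP/(valP x).
  pose q k := LsaType (projS k).
  exists (q (-1), q 0, q 1); split.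
    split; [exact: homogeneous_proj..|].
    by apply/val_inj; rewrite /=; exact: sum_proj.
  move=> [[a b] c] [/= ha hb hc xE].
  have E k := @proj_sum _ _ _ k ha hb hc.
  by congr (_, _, _); apply/val_inj; rewrite /= xE;
    [exact: (E (-1))|exact: (E 0)|exact: (E 1)].
- by move=> k l x y; exact: homogeneous_lie.
Qed.

End Weights.

Lemma transported_3grading (F : fieldType) (L M : lieAlgType F) (phi : L -> M)
    (G : int -> set M) :
  lie_isomorphism phi -> is_3grading G -> is_3grading (transported_grading phi G).
Proof.
move=> [phiL phi_lie [psi phiK psiK]] [G_sub G_out G_dec G_lie].
have phi0 : phi 0 = 0.
  have := phiL 1 0 0; rewrite !scale1r addr0 => /eqP.
  by rewrite -subr_eq0 opprD addrA subrr sub0r oppr_eq0 => /eqP.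
have phiD x y : phi (x + y) = phi x + phi y by rewrite -[x]scale1r phiL !scale1r.
split=> [k|k kN|x|k l x y Gx Gy].
- have [G0 GD] := G_sub k; split; first by rewrite /transported_grading /= phi0.
  by move=> a x y Gx Gy; rewrite /transported_grading /= phiL; exact: GD.
- rewrite /transported_grading G_out //; apply/seteqP; split=> x /=.
    by move=> h; rewrite -[x]phiK h -phi0 phiK.
  by move=> ->.
- have [[[a b] c] [[/= Ga Gb Gc xE] uniq]] := G_dec (phi x).
  exists (psi a, psi b, psi c); split.
    rewrite /transported_grading /= !psiK; split=> //.
    by apply: (can_inj phiK); rewrite xE !phiD !psiK.
  move=> [[a' b'] c'] [/= Ga' Gb' Gc' x'E].
  have [-> -> ->] : (a, b, c) = (phi a', phi b', phi c'); last by rewrite !phiK.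
  by apply: uniq; split=> //=; rewrite x'E !phiD.
- by rewrite /transported_grading /= phi_lie; exact: G_lie.
Qed.

(** Truncation keeps the diagonal in degree 0 and removes it in the other
    degrees, so it preserves trace 0. *)
Lemma sl_3grading (F : fieldType) n : is_3grading (sl_grading F n).
Proof.
pose p : pred nat := fun i => (i < n)%N.
have -> : sl_grading F n = fun k => restrict (homogeneous p k).
  apply: components3_homogeneous => x; split=> h i j; have := h i j;
    rewrite /wt /p; do 2!case: ltnP => _; move=> H K; by [|apply: H].
apply: homogeneous_3grading => k x; rewrite /= /sl_set /= => trx.
have [->|k0] := eqVneq k 0.
  rewrite -[RHS]trx; apply: eq_fsbigr => i _.
  by rewrite /proj_imx /wt subrr.
rewrite /itrace fsbig1 // => i _; rewrite /proj_imx /wt subrr eq_sym.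
by rewrite (negbTE k0).
Qed.

(** The involution exchanges the two halves of the indices, so (i, j) and
    (sigma j, sigma i) have the same degree and truncation preserves the relations
    between entries. *)
Lemma skew_entries_3grading (F : fieldType) (I : choiceType)
    (s : signedInvolution F I) (S : lieSubalgebra (gl F I)) (p : pred I) :
  (forall i, p (sact s i) = ~~ p i) ->
  (forall x, lsa_set S x <-> skew_entries s (gl_val x)) ->
  is_3grading (fun k => restrict (homogeneous p k) : set (lsa_type S)).
Proof.
move=> ps SE; apply: homogeneous_3grading => k x /SE xE; apply/SE => i j.
rewrite /= /proj_imx (_ : wt p (sact s j) (sact s i) = wt p i j).
  by case: ifP => _; rewrite ?xE // mulr0 oppr0.
by rewrite /wt !ps; case: (p i); case: (p j).
Qed.

Definition is_inl (i : nat + nat) : bool := if i is inl _ then true else false.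

Lemma blk_components (F : fieldType) (S : lieSubalgebra (gl F (nat + nat)%type)) :
  components3 (restrict blk_lower : set (lsa_type S))
    (restrict blk_diag) (restrict blk_upper) =
  fun k => restrict (homogeneous is_inl k).
Proof.
have zeroP (x : imatrix F nat nat) : x = 0 <-> forall i j, x i j = 0.
  by split=> [->|h] //; apply: imatrixP.
apply: components3_homogeneous => x; split.
- by move=> [/zeroP ul /zeroP ur /zeroP dr] [i|i] [j|j] //= _;
    [exact: ul|exact: ur|exact: dr].
- by move=> h; split; apply/zeroP => i j; exact: h.
- by move=> [/zeroP ur /zeroP dl] [i|i] [j|j] //= _; [exact: ur|exact: dl].
- by move=> h; split; apply/zeroP => i j; exact: h.
- by move=> [/zeroP ul /zeroP dl /zeroP dr] [i|i] [j|j] //= _;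
    [exact: ul|exact: dl|exact: dr].
- by move=> h; split; apply/zeroP => i j; exact: h.
Qed.

End Gradings.

(** * Congruent forms have conjugate algebras *)

Section BasisChange.
Local Open Scope classical_set_scope.
Local Open Scope ring_scope.
Context {F : fieldType}.
Implicit Types I J K : choiceType.

Lemma imul1mx I J (x : imatrix F I J) : imulmx imx1 x = x.
Proof.
apply: imatrixP => i j; rewrite /imulmx (fsum_unique (t := i)) => [|k ki].
  by rewrite /imx1 eqxx mul1r.
by rewrite /imx1 eq_sym (negbTE ki) mul0r.
Qed.

Lemma imulmx1 I J (x : imatrix F I J) : imulmx x imx1 = x.
Proof.
apply: imatrixP => i j; rewrite /imulmx (fsum_unique (t := j)) => [|k ki].
  by rewrite /imx1 eqxx mulr1.
by rewrite /imx1 (negbTE ki) mulr0.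
Qed.

Lemma itrmx1 I : itrmx imx1 = imx1 :> imatrix F I I.
Proof. by apply: imatrixP => i j; rewrite /itrmx /imx1 eq_sym. Qed.

Lemma imulmx_neq0 I J K (x : imatrix F I J) (y : imatrix F J K) i k :
  imulmx x y i k != 0 -> exists2 j, x i j != 0 & y j k != 0.
Proof.
move=> xy0; apply: contrapT => h; move/eqP: xy0; apply; apply: fsbig1 => j _.
apply/eqP; rewrite mulf_eq0; apply: contrapT => /negP; rewrite negb_or.
by move=> /andP[xij yjk]; apply: h; exists j.
Qed.

Lemma row_finiteM I J K (x : imatrix F I J) (y : imatrix F J K) :
  row_finite x -> row_finite y -> row_finite (imulmx x y).
Proof.
move=> xr yr i; apply: sub_finite_set (bigcup_finite (xr i) (fun j _ => yr j)).
by move=> k /= /imulmx_neq0[j xij yjk]; exists j.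
Qed.

Lemma col_finiteM I J K (x : imatrix F I J) (y : imatrix F J K) :
  col_finite x -> col_finite y -> col_finite (imulmx x y).
Proof.
move=> xc yc j; rewrite -[imulmx x y]itrmxK itrmx_mul.
exact: (@row_finiteM _ _ _ (itrmx y) (itrmx x) yc xc j).
Qed.

Lemma finitary_mull I J K (q : imatrix F I J) (x : imatrix F J K) :
  col_finite q -> finitary x -> finitary (imulmx q x).
Proof.
move=> qc xf.
have fst_f := bigcup_finite (finite_image fst xf) (fun j _ => qc j).
apply: sub_finite_set (finite_setX fst_f (finite_image snd xf)) => -[i k] /=.
by move=> /imulmx_neq0[j qij xjk]; split; [exists j => //|]; exists (j, k).
Qed.

Lemma finitary_mulr I J K (x : imatrix F I J) (p : imatrix F J K) :
  row_finite p -> finitary x -> finitary (imulmx x p).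
Proof.
move=> pr xf; rewrite -[imulmx x p]itrmxK itrmx_mul.
by apply/finitary_tr/finitary_mull/finitary_tr.
Qed.

Section Conjugation.
Context {I J : choiceType} (P : imatrix F I J) (Q : imatrix F J I).
Context (PQ : change_of_basis P Q).

Lemma conj_finitary (x : gl F I) :
  imulmx Q (imulmx x P) \in @finitary_pred F J.
Proof.
have [[Pr Pc] [Qr Qc] _ _] := PQ.
by apply/asboolP; apply: finitary_mull => //; apply: finitary_mulr => //;
  exact: gl_finitary.
Qed.

Definition conj_gl (x : gl F I) : gl F J := Gl (conj_finitary x).

Lemma conj_glZD a (x y : gl F I) : conj_gl (a *: x + y) = a *: conj_gl x + conj_gl y.
Proof.
have [[Pr Pc] [Qr Qc] _ _] := PQ.
apply/val_inj; rewrite /= imulmxDl // imulmxDr //.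
by rewrite imulmxZl imulmxZr.
Qed.

Lemma conj_gl_lie (x y : gl F I) : conj_gl (lie x y) = lie (conj_gl x) (conj_gl y).
Proof.
have [[Pr Pc] [Qr Qc] PQ1 _] := PQ.
have M (u v : gl F I) : imulmx Q (imulmx (imulmx u v) P) =
    imulmx (imulmx Q (imulmx u P)) (imulmx Q (imulmx v P)).
  have [ur uc] := (gl_row_finite u, gl_col_finite u).
  have [vr vc] := (gl_row_finite v, gl_col_finite v).
  have vPc := col_finiteM vc Pc; have uPr := row_finiteM ur Pr.
  have QvPc := col_finiteM Qc vPc.
  rewrite -[RHS]imulmxA // -[in RHS]imulmxA // [imulmx P _]imulmxA // PQ1.
  by rewrite imul1mx -imulmxA.
apply/val_inj; rewrite /= imulmxDl // imulmxNl imulmxDr // imulmxNr.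
by rewrite !M.
Qed.

(** As P Q = 1, the left hand side of the relation for Q x P and the form
    P^t B P is P^t (x^t B + B x) P. *)
Lemma skew_form_conj (B : imatrix F I I) (x : gl F I) :
  row_finite B -> col_finite B -> skew_form B (gl_val x) ->
  skew_form (imulmx (itrmx P) (imulmx B P)) (gl_val (conj_gl x)).
Proof.
move=> Br Bc xB; have [[Pr Pc] [Qr Qc] PQ1 _] := PQ.
have [xr xc] := (gl_row_finite x, gl_col_finite x).
have BPr := row_finiteM Br Pr; have BPc := col_finiteM Bc Pc.
have xPr := row_finiteM xr Pr; have xPc := col_finiteM xc Pc.
have QxPc := col_finiteM Qc xPc.
have left : imulmx (itrmx Q) (imulmx (itrmx P) (imulmx B P)) = imulmx B P.
  by rewrite imulmxA // -itrmx_mul PQ1 itrmx1 imul1mx.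
have right : imulmx P (imulmx Q (imulmx x P)) = imulmx x P.
  by rewrite imulmxA // PQ1 imul1mx.
rewrite /skew_form /= itrmx_mul itrmx_mul.
have Ptxtr : row_finite (imulmx (itrmx P) (itrmx x)) by exact: row_finiteM.
have CPc : col_finite (imulmx (itrmx P) (imulmx B P)) by exact: col_finiteM.
rewrite -[imulmx (imulmx (imulmx _ _) _) _]imulmxA //.
rewrite left -[X in _ + X]imulmxA // -[imulmx (imulmx B P) _]imulmxA // right.
rewrite -[imulmx (imulmx _ (itrmx x)) _]imulmxA // [imulmx (itrmx x) _]imulmxA //.
rewrite [imulmx B (imulmx x P)]imulmxA //.
rewrite -imulmxDr // -imulmxDl // xB.
by rewrite imul0mx imulmx0.
Qed.

End Conjugation.

Lemma change_of_basis_sym I J (P : imatrix F I J) Q :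
  change_of_basis P Q -> change_of_basis Q P.
Proof. by case. Qed.

Lemma conj_glK I J (P : imatrix F I J) Q (PQ : change_of_basis P Q)
  (QP : change_of_basis Q P) : cancel (conj_gl PQ) (conj_gl QP).
Proof.
move=> x; apply/val_inj => /=; have [[Pr Pc] [Qr Qc] PQ1 _] := PQ.
have [xr xc] := (gl_row_finite x, gl_col_finite x).
rewrite -[imulmx (imulmx Q _) Q]imulmxA //.
by rewrite -[imulmx (imulmx x P) Q]imulmxA // PQ1 imulmx1 imulmxA // PQ1 imul1mx.
Qed.

(** Conjugation the other way is inverse to it and of the same kind, because
    P Q = 1 turns P^t B P = C into Q^t C Q = B. *)
Lemma congruent_forms_isomorphism I J (S : lieSubalgebra (gl F I))
    (T : lieSubalgebra (gl F J)) (B : imatrix F I I) (C : imatrix F J J)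
    (P : imatrix F I J) (Q : imatrix F J I) :
  (forall x, lsa_set S x <-> skew_form B (gl_val x)) ->
  (forall x, lsa_set T x <-> skew_form C (gl_val x)) ->
  row_finite B -> col_finite B -> change_of_basis P Q ->
  imulmx (itrmx P) (imulmx B P) = C ->
  exists phi : lsa_type S -> lsa_type T, basis_change_isomorphism phi.
Proof.
move=> SE TE Br Bc PQ CE; have QP := change_of_basis_sym PQ.
have [[Pr Pc] [Qr Qc] PQ1 QP1] := PQ.
have BPr := row_finiteM Br Pr; have BPc := col_finiteM Bc Pc.
have Cr : row_finite C by rewrite -CE; exact: row_finiteM.
have Cc : col_finite C by rewrite -CE; exact: col_finiteM.
have BE : imulmx (itrmx Q) (imulmx C Q) = B.
  rewrite -CE -[imulmx (imulmx _ _) Q]imulmxA // -[imulmx (imulmx B P) Q]imulmxA // PQ1 imulmx1.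
  by rewrite imulmxA // -itrmx_mul PQ1 itrmx1 imul1mx.
have phiP (x : lsa_type S) : conj_gl PQ (lsa_val x) \in lsa_pred T.
  by apply/asboolP/TE; rewrite -CE; apply: skew_form_conj => //;
    apply/SE/asboolP/(valP x).
have psiP (x : lsa_type T) : conj_gl QP (lsa_val x) \in lsa_pred S.
  by apply/asboolP/SE; rewrite -BE; apply: skew_form_conj => //;
    apply/TE/asboolP/(valP x).
exists (fun x => LsaType (phiP x)); split; last by exists P, Q.
split=> [a x y|x y|].
- by apply/val_inj; exact: conj_glZD.
- by apply/val_inj; exact: conj_gl_lie.
- by exists (fun x => LsaType (psiP x)) => x; apply/val_inj; exact: conj_glK.
Qed.

(** * Block diagonal matrices with equal 2 x 2 blocks *)

Section BlockDiagonal.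

(** The maps [f] and [g] send an index to the number of its block and its place
    in the block, which makes sense of the same matrix for different
    enumerations of rows and columns. *)
Definition blockdiag I J (f : I -> nat * bool) (g : J -> nat * bool)
    (m : imatrix F bool bool) : imatrix F I J :=
  fun i j => if (f i).1 == (g j).1 then m (f i).2 (g j).2 else 0.

Lemma blockdiag_tr I J (f : I -> nat * bool) (g : J -> nat * bool) m :
  itrmx (blockdiag f g m) = blockdiag g f (itrmx m).
Proof. by apply: imatrixP => i j; rewrite /itrmx /blockdiag eq_sym. Qed.

Lemma blockdiagM I J K (f : I -> nat * bool) (g : J -> nat * bool)
    (h : K -> nat * bool) m n : bijective g ->
  imulmx (blockdiag f g m) (blockdiag g h n) = blockdiag f h (imulmx m n).
Proof.
move=> [g' gK g'K]; apply: imatrixP => i k.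
have g'inj := can_inj g'K.
rewrite [LHS](fsum_pair (s := g' ((f i).1, true)) (t := g' ((f i).1, false))).
- rewrite /blockdiag !g'K eqxx; case: ifP => _; last by rewrite !mulr0 addr0.
  by rewrite [RHS](fsum_pair (s := true) (t := false)) // => -[].
- by rewrite (inj_eq g'inj) xpair_eqE eqxx.
- move=> j; rewrite -[j]gK !(inj_eq g'inj) gK /blockdiag.
  case: (g j) => a b; rewrite !xpair_eqE /=; have [<-|_] := eqVneq (f i).1 a; last by rewrite mul0r.
  by case: b; rewrite eqxx.
Qed.

Lemma blockdiag1 I (f : I -> nat * bool) : injective f ->
  blockdiag f f imx1 = imx1.
Proof.
move=> finj; apply: imatrixP => i j.
rewrite /blockdiag /imx1 -(inj_eq finj i j).
case: (f i) => a b; case: (f j) => c d /=; rewrite xpair_eqE.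
by case: eqP.
Qed.

Lemma blockdiag_row_finite I J (f : I -> nat * bool) (g : J -> nat * bool) m :
  bijective g -> row_finite (blockdiag f g m).
Proof.
move=> [g' gK g'K] i.
apply: sub_finite_set (finite_seq [:: g' ((f i).1, true); g' ((f i).1, false)]).
move=> j /=; rewrite -[j]gK /blockdiag !inE !(inj_eq (can_inj g'K)) gK.
case: (g j) => a b; rewrite !xpair_eqE /=; have [_ _|_] := eqVneq (f i).1 a; last by rewrite eqxx.
by case: b; rewrite eqxx ?orbT.
Qed.

Lemma blockdiag_col_finite I J (f : I -> nat * bool) (g : J -> nat * bool) m :
  bijective f -> col_finite (blockdiag f g m).
Proof.
move=> fbij j; have := @blockdiag_row_finite _ _ g f (itrmx m) fbij j.
by rewrite -blockdiag_tr.
Qed.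

(** Repeating a 2 x 2 block is compatible with products, transposition and the
    identity, so a congruence of 2 x 2 forms yields one of infinite forms. *)
Lemma blockdiag_isomorphism I J (S : lieSubalgebra (gl F I))
    (T : lieSubalgebra (gl F J)) (f : I -> nat * bool) (g : J -> nat * bool)
    (b c m n : imatrix F bool bool) :
  bijective f -> bijective g ->
  (forall x, lsa_set S x <-> skew_form (blockdiag f f b) (gl_val x)) ->
  (forall x, lsa_set T x <-> skew_form (blockdiag g g c) (gl_val x)) ->
  imulmx m n = imx1 -> imulmx n m = imx1 -> imulmx (itrmx m) (imulmx b m) = c ->
  exists phi : lsa_type S -> lsa_type T, basis_change_isomorphism phi.
Proof.
move=> fbij gbij SE TE mn nm mbm.
apply: (congruent_forms_isomorphism (P := blockdiag f g m)
  (Q := blockdiag g f n) SE TE).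
- exact: blockdiag_row_finite.
- exact: blockdiag_col_finite.
- split; first by split; [exact: blockdiag_row_finite|exact: blockdiag_col_finite].
  + by split; [exact: blockdiag_row_finite|exact: blockdiag_col_finite].
  + by rewrite blockdiagM // mn blockdiag1 //; exact: bij_inj.
  + by rewrite blockdiagM // nm blockdiag1 //; exact: bij_inj.
- by rewrite blockdiag_tr !blockdiagM // mbm.
Qed.

End BlockDiagonal.

End BasisChange.

(** * The orthogonal and symplectic forms *)

Section Forms.
Local Open Scope classical_set_scope.
Local Open Scope ring_scope.
Context {F : fieldType}.

Definition transpose_involution (I : choiceType) : signedInvolution F I :=
  @SignedInvolution F I id (fun=> 1) 1 (fun=> erefl) (fun=> mulr1 1)
    (fun=> esym (mulr1 1)) (or_introl erefl).

Lemma monomial_transpose (I : choiceType) :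
  monomial (transpose_involution I) = imx1.
Proof.
by apply: imatrixP => i j; rewrite /monomial /imx1 /= eq_sym; case: eqP.
Qed.

(** The matrix [[0, 1], [e, 0]], with [false] as first index. *)
Definition hyperbolic (e : F) : imatrix F bool bool :=
  fun a b => if b == ~~ a then (if a then e else 1) else 0.

(** A numbering [f] of the indices by blocks of two yields the involution that
    exchanges the two places of each block, with the sign [e] at the second
    place. *)
Section Pairing.
Context {I : choiceType} {f : I -> nat * bool} {g : nat * bool -> I}.
Context (fK : cancel f g) (gK : cancel g f) {e : F} (e_pm : e = 1 \/ e = -1).

Let act i := g ((f i).1, ~~ (f i).2).
Let sgn i := if (f i).2 then e else 1.

Lemma pairing_actK : involutive act.
Proof. by move=> i; rewrite /act gK /= negbK -surjective_pairing fK. Qed.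

Lemma pairing_sgn2 i : sgn i * sgn i = 1.
Proof.
rewrite /sgn; case: ifP => _; last by rewrite mulr1.
by case: e_pm => ->; rewrite ?mulrNN mulr1.
Qed.

Lemma pairing_sgn_act i : sgn (act i) = e * sgn i.
Proof.
rewrite /sgn /act gK /=; case: (f i).2; last by rewrite mulr1.
by case: e_pm => ->; rewrite ?mulrNN mulr1.
Qed.

Definition pairing_involution : signedInvolution F I :=
  SignedInvolution pairing_actK pairing_sgn2 pairing_sgn_act e_pm.

Lemma monomial_pairing :
  monomial pairing_involution = blockdiag f f (hyperbolic e).
Proof.
apply: imatrixP => i j; rewrite /monomial /blockdiag /hyperbolic /= /act /sgn.
rewrite -(can_eq fK) gK; case: (f i) => a b; case: (f j) => c d /=.
by rewrite xpair_eqE eq_sym; case: eqP.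
Qed.

End Pairing.

Definition nat_split (n : nat) : nat * bool := (n./2, odd n).
Definition nat_join (c : nat * bool) : nat := (c.2 + c.1.*2)%N.

Lemma nat_splitK : cancel nat_split nat_join.
Proof. by move=> n; rewrite /nat_join /= odd_double_half. Qed.

Lemma nat_joinK : cancel nat_join nat_split.
Proof.
move=> [a b]; rewrite /nat_split /nat_join /= oddD odd_double addbF.
by case: b => /=; rewrite ?add0n ?doubleK ?add1n /= ?uphalf_double.
Qed.

Definition blk_split (i : nat + nat) : nat * bool :=
  match i with inl k => (k, false) | inr k => (k, true) end.
Definition blk_join (c : nat * bool) : nat + nat :=
  if c.2 then inr c.1 else inl c.1.

Lemma blk_splitK : cancel blk_split blk_join. Proof. by case. Qed.
Lemma blk_joinK : cancel blk_join blk_split. Proof. by case=> a []. Qed.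

Lemma nat_split_bij : bijective nat_split.
Proof. exists nat_join; [exact: nat_splitK|exact: nat_joinK]. Qed.
Lemma blk_split_bij : bijective blk_split.
Proof. exists blk_join; [exact: blk_splitK|exact: blk_joinK]. Qed.

Lemma sp_form_blockdiag :
  sp_form F = blockdiag nat_split nat_split (hyperbolic (-1)).
Proof.
apply: imatrixP => i j; rewrite /sp_form /blockdiag /hyperbolic.
rewrite -[i]nat_splitK -[j]nat_splitK !nat_joinK.
case: (nat_split i) => a b; case: (nat_split j) => c d.
rewrite /nat_join /= !oddD !odd_double !addbF.
by case: b; case: d => /=; repeat case: eqP => //; lia.
Qed.

Lemma o_setE (x : gl F nat) : o_set x <-> skew_form imx1 (gl_val x).
Proof. by rewrite /skew_form imulmx1 imul1mx. Qed.

Definition sp_involution : signedInvolution F nat :=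
  pairing_involution nat_splitK nat_joinK (or_intror (erefl (-1))).

Lemma sp_setE (x : gl F nat) : sp_set x <-> skew_entries sp_involution (gl_val x).
Proof. by rewrite -skew_monomialP monomial_pairing -sp_form_blockdiag. Qed.

Definition blk_involution e (e_pm : e = 1 \/ e = -1 :> F) :=
  pairing_involution blk_splitK blk_joinK e_pm.

Lemma blk_skew_entriesP e (e_pm : e = 1 \/ e = -1 :> F)
    (x : imatrix F (nat + nat)%type (nat + nat)%type) :
  skew_entries (blk_involution e_pm) x <->
  forall i j, x (blk_swap j) (blk_swap i) = - (blk_sign e i * blk_sign e j * x i j).
Proof. by split=> h i j; move: (h i j); case: i => i; case: j => j. Qed.

Lemma o_block_setE (x : gl F (nat + nat)%type) : o_block_set x <->
  skew_entries (blk_involution (or_introl (erefl 1))) (gl_val x).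
Proof. by rewrite o_block_setP blk_skew_entriesP. Qed.

Lemma sp_block_setE (x : gl F (nat + nat)%type) : sp_block_set x <->
  skew_entries (blk_involution (or_intror (erefl (-1)))) (gl_val x).
Proof. by rewrite sp_block_setP blk_skew_entriesP. Qed.

Lemma o_block_3grading : is_3grading (o_block_grading F).
Proof.
rewrite /o_block_grading blk_components.
by apply: (skew_entries_3grading (S := o_block_subalgebra F) _ o_block_setE) => -[].
Qed.

Lemma sp_block_3grading : is_3grading (sp_block_grading F).
Proof.
rewrite /sp_block_grading blk_components.
by apply: (skew_entries_3grading (S := sp_block_subalgebra F) _ sp_block_setE) => -[].
Qed.

(** In each plane with orthonormal basis u, v, the vectors u + i v and
    (u - i v) / 2 are isotropic with product 1.  They are the columns of [m], and
    [n] is the transpose of [m] with its rows exchanged. *)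
Lemma o_isomorphism (i : F) : i * i = -1 -> 2 != 0 :> F ->
  exists phi : o_infty F -> o_block F, basis_change_isomorphism phi.
Proof.
move=> i2 two_neq0; have [h h2] : exists h : F, 2 * h = 1.
  by exists 2^-1; rewrite divff.
pose m : imatrix F bool bool := fun a b =>
  match a, b with
  | false, false => 1 | false, true => h
  | true, false => i | true, true => - (i * h) end.
pose n : imatrix F bool bool := fun a b => m b (~~ a).
have M (u v : imatrix F bool bool) a c :
    imulmx u v a c = u a true * v true c + u a false * v false c.
  by rewrite [LHS](fsum_pair (s := true) (t := false)) // => -[].
apply: (@blockdiag_isomorphism F _ _ _ _ nat_split blk_split
  imx1 (hyperbolic 1) m n).
- exact: nat_split_bij.
- exact: blk_split_bij.
- by move=> x; rewrite blockdiag1; [exact: o_setE|exact: can_inj nat_splitK].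
- by move=> x; rewrite -(monomial_pairing blk_splitK blk_joinK (or_introl erefl))
    skew_monomialP; exact: o_block_setE.
- by apply: imatrixP => -[] []; rewrite M /n /m /imx1 /=; ring: i2 h2.
- by apply: imatrixP => -[] []; rewrite M /n /m /imx1 /=; ring: i2 h2.
- rewrite imul1mx; apply: imatrixP => -[] [];
    by rewrite M /itrmx /m /hyperbolic /=; ring: i2 h2.
Qed.

(** The two symplectic algebras differ by the enumeration of the basis only: the
    vectors numbered 2k and 2k+1 become the [k]-th ones of the two halves. *)
Lemma sp_isomorphism :
  exists phi : sp_infty F -> sp_block F, basis_change_isomorphism phi.
Proof.
apply: (@blockdiag_isomorphism F _ _ _ _ nat_split blk_split
  (hyperbolic (-1)) (hyperbolic (-1)) imx1 imx1).
- exact: nat_split_bij.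
- exact: blk_split_bij.
- by move=> x; rewrite -sp_form_blockdiag.
- by move=> x; rewrite -(monomial_pairing blk_splitK blk_joinK (or_intror erefl))
    skew_monomialP; exact: sp_block_setE.
- by rewrite imulmx1.
- by rewrite imulmx1.
- by rewrite itrmx1 imulmx1 imul1mx.
Qed.

Lemma o_nondegenerate : 2 != 0 :> F -> strongly_nondegenerate (o_infty F).
Proof.
move=> two_neq0; apply: (skew_nondegenerate (s := transpose_involution nat) two_neq0
  infinite_nat) => x.
by rewrite -skew_monomialP monomial_transpose; exact: o_setE.
Qed.

Lemma sp_nondegenerate : 2 != 0 :> F -> strongly_nondegenerate (sp_infty F).
Proof.
move=> two_neq0; apply: (skew_nondegenerate two_neq0 infinite_nat) => x.
exact: sp_setE.
Qed.

Lemma graded_nondegenerate (L : lieAlgType F) (G : int -> set L) :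
  strongly_nondegenerate L -> is_3grading G -> graded_strongly_nondegenerate G.
Proof. by move=> Lnd G3; split=> // x _; exact: Lnd. Qed.

End Forms.

Lemma closedField_sqrtN1 (F : closedFieldType) : exists i : F, (i * i = -1)%R.
Proof.
have [i] := @solve_monicpoly F 2 (fun k => if k == 0 then -1 else 0)%R isT.
rewrite !big_ord_recl big_ord0 /= expr2 => iE; exists i.
by rewrite iE mul0r !addr0 mulr1.
Qed.

Theorem theorem4p2 (F : closedFieldType) (charF0 : [pchar F]%R =i pred0) :
  [/\ (forall n : nat, 0 < n -> graded_strongly_nondegenerate (sl_grading F n)),
      (exists phi : o_infty F -> o_block F, basis_change_isomorphism phi) /\
      (forall phi : o_infty F -> o_block F, basis_change_isomorphism phi ->
         graded_strongly_nondegenerate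
           (transported_grading phi (o_block_grading F))) &
      (exists phi : sp_infty F -> sp_block F, basis_change_isomorphism phi) /\
      (forall phi : sp_infty F -> sp_block F, basis_change_isomorphism phi ->
         graded_strongly_nondegenerate
           (transported_grading phi (sp_block_grading F)))] /\
  [/\ strongly_nondegenerate (sl_infty F),
      strongly_nondegenerate (o_infty F) &
      strongly_nondegenerate (sp_infty F)].
Proof.
have two_neq0 : (2 != 0 :> F)%R by have /pcharf0P -> := charF0.
have [i i2] := closedField_sqrtN1 F.
have sl_nd := sl_nondegenerate two_neq0.
have o_nd := o_nondegenerate two_neq0.
have sp_nd := sp_nondegenerate two_neq0.
split=> //; split=> [n _||].
- exact/graded_nondegenerate/sl_3grading.
- split=> [|phi [phi_iso _]]; first exact: o_isomorphism i2 two_neq0.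
  exact/graded_nondegenerate/transported_3grading/o_block_3grading.
- split=> [|phi [phi_iso _]]; first exact: sp_isomorphism.
  exact/graded_nondegenerate/transported_3grading/sp_block_3grading.
Qed.
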